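(* Let $\xi,\eta\in \mathrm{c}_{\mathrm{o}}^*$ with $\xi_n>0$ for every $n$. If $\xi\prec\eta$, then there is a canonical co-isometry $W(\xi,\eta)$ with real entries (namely the infinite matrix $W(\xi,\eta)$ produced by the construction described in the context) whose Schur-square $Q(\xi,\eta)$, given by $Q(\xi,\eta)_{ij}=(W(\xi,\eta)_{ij})^2$, satisfies $\xi=Q(\xi,\eta)\,\eta$.
   Context: $\mathrm{c}_{\mathrm{o}}^*$ denotes the cone of nonnegative monotone nonincreasing sequences $\xi=\langle\xi_1,\xi_2,\dots\rangle$ converging to $0$ (not a dual space). For $\xi,\eta\in \mathrm{c}_{\mathrm{o}}^*$, $\xi\prec\eta$ means $\sum_{j=1}^n\xi_j\le\sum_{j=1}^n\eta_j$ for every $n\in\mathbb N$. Infinite matrices are identified with operators on $\ell^2$ via the standard orthonormal basis; a co-isometry is an operator $W$ with $WW^*=I$. For a matrix $Q$ with nonnegative entries and row sums at most $1$ and a bounded sequence $\eta$, $(Q\eta)_i:=\sum_j Q_{ij}\eta_j$. Construction of $W(\xi,\eta)$ (for $\xi,\eta\in \mathrm{c}_{\mathrm{o}}^*$, $\xi\prec\eta$, all $\xi_n>0$). Set $\rho(0):=\eta$. For $k\ge 1$, given the nonincreasing sequence $\rho(k-1)$, let $m_k\in\mathbb N$ be the unique positive integer with $\rho(k-1)_{m_k+1}<\xi_k\le\rho(k-1)_{m_k}$, let $t_k\in(0,1]$ be the unique number with $\xi_k=t_k\rho(k-1)_{m_k}+(1-t_k)\rho(k-1)_{m_k+1}$,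 let $\delta_k:=(1-t_k)\rho(k-1)_{m_k}+t_k\rho(k-1)_{m_k+1}$, and define $\rho(k)$ by $\rho(k)_j=\rho(k-1)_j$ for $j<m_k$, $\rho(k)_{m_k}=\delta_k$, and $\rho(k)_j=\rho(k-1)_{j+1}$ for $j>m_k$. (The process can be carried on for all $k$.) For $m\ge1$ and $0<t\le1$ let $V(m,t)$ be the $(m+1)\times(m+1)$ real orthogonal matrix whose entries are $V_{1,m}=\sqrt t$, $V_{1,m+1}=-\sqrt{1-t}$, $V_{i,i-1}=1$ for $2\le i\le m$, $V_{m+1,m}=\sqrt{1-t}$, $V_{m+1,m+1}=\sqrt t$, all other entries being $0$. With $I_n$ the $n\times n$ identity ($1\le n\le\infty$; $I_0$ is dropped), let $$W^{(n)}:=(I_{n-1}\oplus V(m_n,t_n)\oplus I_\infty)(I_{n-2}\oplus V(m_{n-1},t_{n-1})\oplus I_\infty)\cdots(I_1\oplus V(m_2,t_2)\oplus I_\infty)(V(m_1,t_1)\oplus I_\infty).$$ The first $n$ rows of $W^{(j)}$ are the same for all $j\ge n$, and $W(\xi,\eta)$ is the infinite matrix whose first $n$ rows are those of $W^{(n)}$, for every $n$ (equivalently, the weak operator limit of $W^{(n)}$). *)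

(* Defs.v *)
From Stdlib Require Import Reals Arith Bool.
From Coquelicot Require Import Coquelicot.
Open Scope R_scope.

(* All sequences and infinite matrices are indexed from 0:
   [xi n] is the (n+1)-st term, [W i j] the (i+1, j+1) entry. *)

Definition c0star (xi : nat -> R) : Prop :=
  (forall n, 0 <= xi n) /\ (forall n, xi (S n) <= xi n) /\ is_lim_seq xi 0.

(* [sum_n a n] is a 0 + ... + a n, so n = 0 is the first nonempty partial sum. *)
Definition majorized (xi eta : nat -> R) : Prop :=
  forall n, sum_n xi n <= sum_n eta n.

Definition imatrix : Type := nat -> nat -> R.

Definition iid : imatrix := fun i j => if i =? j then 1 else 0.

Definition imul (A B : imatrix) : imatrix :=
  fun i j => Series (fun k => A i k * B k j).

(* I_n (+) A (+) I_infinity, where only the leading d x d block of A is used. *)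
Definition block (n d : nat) (A : imatrix) : imatrix := fun i j =>
  if (n <=? i) && (i <? n + d) && (n <=? j) && (j <? n + d)
  then A (i - n)%nat (j - n)%nat
  else iid i j.

(* The (m+1) x (m+1) matrix V(m,t), for 1 <= m: its first row is
   (0,...,0, sqrt t, - sqrt (1-t)), its last row (0,...,0, sqrt (1-t), sqrt t),
   and its rows in between form a shifted identity. *)
Definition V (m : nat) (t : R) : imatrix := fun i j =>
  if i =? 0 then
    if j =? m - 1 then sqrt t else if j =? m then - sqrt (1 - t) else 0
  else if i <? m then
    if j =? i - 1 then 1 else 0
  else if i =? m then
    if j =? m - 1 then sqrt (1 - t) else if j =? m then sqrt t else 0
  else 0.

(* One step r -> r' of the construction, with target x. Here m counts from 1,
   so that r (m - 1) and r m are the m-th and (m+1)-st terms of r. *)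
Definition step (x : R) (r : nat -> R) (m : nat) (t : R) (r' : nat -> R) : Prop :=
  (1 <= m)%nat /\ r m < x <= r (m - 1)%nat /\
  0 < t <= 1 /\ x = t * r (m - 1)%nat + (1 - t) * r m /\
  (forall j, (j < m - 1)%nat -> r' j = r j) /\
  r' (m - 1)%nat = (1 - t) * r (m - 1)%nat + t * r m /\
  (forall j, (m - 1 < j)%nat -> r' j = r (S j)).

(* [m k] and [t k] are the parameters of the (k+1)-st step, leading from
   [rho k] to [rho (S k)]. *)
Definition steps (xi eta : nat -> R)
    (rho : nat -> nat -> R) (m : nat -> nat) (t : nat -> R) : Prop :=
  (forall j, rho O j = eta j) /\
  (forall k, step (xi k) (rho k) (m k) (t k) (rho (S k))).

Fixpoint Wn (m : nat -> nat) (t : nat -> R) (n : nat) : imatrix :=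
  match n with
  | O => iid
  | S p => imul (block p (S (m p)) (V (m p) (t p))) (Wn m t p)
  end.

(* W agrees with W^(n) on its first n rows, for every n. *)
Definition is_W (xi eta : nat -> R) (W : imatrix) : Prop :=
  exists rho m t, steps xi eta rho m t /\
    forall n i j, (i < n)%nat -> W i j = Wn m t n i j.

Definition schur_square (W : imatrix) : imatrix := fun i j => (W i j) ^ 2.

(* x = Q y, the convergence of the series being part of the assertion. *)
Definition is_apply (Q : imatrix) (y x : nat -> R) : Prop :=
  forall i, is_series (fun j => Q i j * y j) (x i).

Definition ell2 (x : nat -> C) : Prop := ex_series (fun n => (Cmod (x n)) ^ 2).

Definition norm2 (x : nat -> C) : R := sqrt (Series (fun n => (Cmod (x n)) ^ 2)).

(* Only used for x, y in ell2, where both series converge absolutely. *)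
Definition inner (x y : nat -> C) : C :=
  (Series (fun n => Re (x n * Cconj (y n))%C),
   Series (fun n => Im (x n * Cconj (y n))%C)).

Definition basis (j : nat) : nat -> C := fun i => RtoC (iid i j).

(* Bounded linear operators on ell2; values of T outside ell2 are irrelevant. *)
Definition bounded_op (T : (nat -> C) -> (nat -> C)) : Prop :=
  (forall x, ell2 x -> ell2 (T x)) /\
  (forall x y, ell2 x -> ell2 y ->
     forall n, T (fun k => (x k + y k)%C) n = (T x n + T y n)%C) /\
  (forall (a : C) x, ell2 x ->
     forall n, T (fun k => (a * x k)%C) n = (a * T x n)%C) /\
  (exists M : R, forall x, ell2 x -> norm2 (T x) <= M * norm2 x).

Definition adjoint (T Tstar : (nat -> C) -> (nat -> C)) : Prop :=
  forall x y, ell2 x -> ell2 y -> inner (T x) y = inner x (Tstar y).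

Definition op_coisometry (T : (nat -> C) -> (nat -> C)) : Prop :=
  exists Tstar, bounded_op Tstar /\ adjoint T Tstar /\
    forall x, ell2 x -> forall n, T (Tstar x) n = x n.

Definition matrix_of (T : (nat -> C) -> (nat -> C)) (W : imatrix) : Prop :=
  forall i j, inner (T (basis j)) (basis i) = RtoC (W i j).

Definition coisometry (W : imatrix) : Prop :=
  exists T, bounded_op T /\ matrix_of T W /\ op_coisometry T.

(* Main.v *)
(* The matrix [W^(n+1)] arises from [W^(n)] by acting on two of the rows of index
   at least [n]: with pivots [u] and [v], the row [sqrt t u - sqrt (1-t) v] is
   emitted and [sqrt (1-t) u + sqrt t v] replaces the pair. All rows stay
   orthonormal, and the rows not yet emitted have pairwise disjoint supports. Hence
   squaring the entries commutes with these combinations, and inductively the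
   squared rows not yet emitted, applied to [eta], give [rho n], while the emitted
   row gives [t rho_m + (1-t) rho_(m+1) = xi_n]. Majorization survives every step for
   the shifted sequence [xi] and the current [rho], which guarantees that the next
   step exists. Finally, a matrix with orthonormal rows is a co-isometry: Bessel's
   inequality bounds it and, by duality, its transpose, and a real matrix acts on
   real and imaginary parts separately. *)
Require Import Defs.
From Stdlib Require Import Reals Arith Bool Lia Lra.
From Stdlib Require Import Classical IndefiniteDescription FunctionalExtensionality.
From Coquelicot Require Import Coquelicot.
Open Scope R_scope.

(** * Series of reals *)

Lemma is_series_lin (c d : R) (f g : nat -> R) (a b : R) :
  is_series f a -> is_series g b ->
  is_series (fun n => c * f n + d * g n) (c * a + d * b).
Proof.
  intros Hf Hg. exact (is_series_plus _ _ _ _ (is_series_scal c _ _ Hf) (is_series_scal d _ _ Hg)).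
Qed.

Lemma is_series_eq (f g : nat -> R) (a b : R) :
  is_series f a -> (forall n, f n = g n) -> a = b -> is_series g b.
Proof. intros H E <-. exact (is_series_ext _ _ _ E H). Qed.

Lemma iid_sym (i j : nat) : iid i j = iid j i.
Proof. unfold iid. rewrite Nat.eqb_sym. reflexivity. Qed.

Lemma sum_n_succ (a : nat -> R) (n : nat) : sum_n a (S n) = sum_n a n + a (S n).
Proof. exact (sum_Sn a n). Qed.

(** The partial sums are 0 before index [p] and equal [f p] from there on. *)
Lemma is_series_iid (p : nat) (f : nat -> R) :
  is_series (fun k => iid p k * f k) (f p).
Proof.
  assert (H : forall n, sum_n (fun k => iid p k * f k) n = if p <=? n then f p else 0).
  { induction n as [|n IH].
    - rewrite sum_O. unfold iid. destruct p; simpl; ring.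
    - rewrite sum_n_succ, IH. unfold iid.
      destruct (Nat.leb_spec p n), (Nat.leb_spec p (S n)), (Nat.eqb_spec p (S n));
        try lia; subst; simpl; ring. }
  change (is_lim_seq (sum_n (fun k => iid p k * f k)) (f p)).
  apply (is_lim_seq_ext_loc (fun _ => f p)); [|apply is_lim_seq_const].
  exists p. intros n Hn. rewrite H. destruct (Nat.leb_spec p n); [reflexivity|lia].
Qed.

(** * Rows of the approximating matrices *)

Ltac if_free a := lazymatch a with context [if _ then _ else _] => fail | _ => idtac end.

(* Conditions of inner conditionals are decided before the comparisons they occur in. *)
Ltac index_cases :=
  repeat (match goal with
    | |- context [Nat.ltb ?a ?b] => if_free a; if_free b; destruct (Nat.ltb_spec a b)
    | |- context [Nat.leb ?a ?b] => if_free a; if_free b; destruct (Nat.leb_spec a b)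
    | |- context [Nat.eqb ?a ?b] => if_free a; if_free b; destruct (Nat.eqb_spec a b)
    end; try (exfalso; lia); cbv beta iota delta [andb orb]).

(** Row [i] of the embedded [V m t] has at most two nonzero entries: [coef1] in column [idx1] and
    [coef2] in column [n + m]. Rows strictly between [n] and [n + m] are shifted by one, and rows
    outside the block are left fixed. *)
Definition coef1 (n m : nat) (t : R) (i : nat) : R :=
  if i =? n then sqrt t else if i =? n + m then sqrt (1 - t) else 1.
Definition coef2 (n m : nat) (t : R) (i : nat) : R :=
  if i =? n then - sqrt (1 - t) else if i =? n + m then sqrt t else 0.
Definition idx1 (n m : nat) (i : nat) : nat :=
  if (i =? n) || (i =? n + m) then (n + m - 1)%nat
  else if (n <? i) && (i <? n + m) then (i - 1)%nat else i.

Lemma block_row (n m : nat) (t : R) (i k : nat) : (1 <= m)%nat ->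
  block n (S m) (V m t) i k
  = coef1 n m t i * iid (idx1 n m i) k + coef2 n m t i * iid (n + m)%nat k.
Proof.
  intros Hm. unfold block, V, coef1, coef2, idx1, iid.
  index_cases; ring.
Qed.

Lemma imul_block_row (n m : nat) (t : R) (B : imatrix) (i j : nat) :
  (1 <= m)%nat ->
  imul (block n (S m) (V m t)) B i j
  = coef1 n m t i * B (idx1 n m i) j + coef2 n m t i * B (n + m)%nat j.
Proof.
  intros Hm. apply is_series_unique.
  eapply is_series_eq;
    [apply (is_series_lin (coef1 n m t i) (coef2 n m t i));
     apply is_series_iid with (f := fun k => B k j)
    | |reflexivity].
  intros k. cbv beta. rewrite block_row by exact Hm. ring.
Qed.

Lemma Wn_succ (m : nat -> nat) (t : nat -> R) (n i j : nat) :
  (1 <= m n)%nat ->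
  Wn m t (S n) i j = coef1 n (m n) (t n) i * Wn m t n (idx1 n (m n) i) j
                     + coef2 n (m n) (t n) i * Wn m t n (n + m n)%nat j.
Proof. intros Hm. apply (imul_block_row n (m n) (t n) (Wn m t n) i j Hm). Qed.

(** Multiplying by the block that starts at [n] fixes every row [i < n]: there [coef1] is 1, [coef2]
    is 0 and [idx1] is [i]. *)
Lemma Wn_stable (m : nat -> nat) (t : nat -> R) (hm : forall k, (1 <= m k)%nat)
    (n i j : nat) :
  (i < n)%nat -> Wn m t n i j = Wn m t (S i) i j.
Proof.
  induction n as [|n IH]; intros Hi; [lia|].
  destruct (Nat.eq_dec i n) as [->|Hne]; [reflexivity|].
  rewrite <- IH by lia. rewrite Wn_succ by apply hm.
  unfold coef1, coef2, idx1; index_cases; ring.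
Qed.

Lemma Wn_orthonormal (m : nat -> nat) (t : nat -> R)
    (hm : forall k, (1 <= m k)%nat) (ht : forall k, 0 < t k <= 1) (n i k : nat) :
  is_series (fun j => Wn m t n i j * Wn m t n k j) (iid i k).
Proof.
  revert i k. induction n as [|n IH]; intros i k.
  - simpl. rewrite (iid_sym i k). exact (is_series_iid i (iid k)).
  - set (a := coef1 n (m n) (t n)). set (b := coef2 n (m n) (t n)).
    set (p := idx1 n (m n)). set (q := (n + m n)%nat).
    (* By bilinearity, the pairing of two new rows splits into four pairings of old rows, each known
       by induction. *)
    pose proof (is_series_lin 1 1 _ _ _ _
      (is_series_lin (a i * a k) (a i * b k) _ _ _ _ (IH (p i) (p k)) (IH (p i) q))
      (is_series_lin (b i * a k) (b i * b k) _ _ _ _ (IH q (p k)) (IH q q))) as H.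
    eapply is_series_eq; [exact H | |].
    + intros j. cbv beta. rewrite !Wn_succ by apply hm. fold a b p q. ring.
    + pose proof (sqrt_sqrt (t n) ltac:(specialize (ht n); lra)) as E1.
      pose proof (sqrt_sqrt (1 - t n) ltac:(specialize (ht n); lra)) as E2.
      pose proof (hm n) as Hm.
      clear H. subst a b p q.
      (* What remains is the orthogonality of [V], which rests on [t + (1 - t) = 1] and on the
         opposite signs in its two mixed rows. *)
      unfold iid, coef1, coef2, idx1; index_cases; nra.
Qed.

(** Of the two rows that mix the pivots, row [n] is emitted and leaves the range, so each old
    support is inherited by only one remaining row. *)
Lemma Wn_tail_disjoint (m : nat -> nat) (t : nat -> R) (hm : forall k, (1 <= m k)%nat)
    (n i k j : nat) :
  (n <= i)%nat -> (n <= k)%nat -> i <> k -> Wn m t n i j * Wn m t n k j = 0.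
Proof.
  revert i k. induction n as [|n IH]; intros i k Hi Hk Hik.
  - simpl. unfold iid. index_cases; ring.
  - rewrite !Wn_succ by apply hm.
    pose proof (hm n) as Hm.
    pose proof (fun p (Hp : (n <= p)%nat) (Hq : p <> (n + m n)%nat) =>
      IH p (n + m n)%nat Hp ltac:(lia) Hq) as IHq.
    pose proof (IH (idx1 n (m n) i) (idx1 n (m n) k)) as IHik.
    pose proof (IHq (idx1 n (m n) i)) as IHi.
    pose proof (IHq (idx1 n (m n) k)) as IHk.
    set (P := Wn m t n) in *.
    set (a := coef1 n (m n) (t n)). set (b := coef2 n (m n) (t n)).
    transitivity (
      a i * a k * (P (idx1 n (m n) i) j * P (idx1 n (m n) k) j)
      + a i * b k * (P (idx1 n (m n) i) j * P (n + m n)%nat j)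
      + b i * a k * (P (idx1 n (m n) k) j * P (n + m n)%nat j)
      + b i * b k * (P (n + m n)%nat j * P (n + m n)%nat j)); [ring|].
    (* Beyond row [n], only row [n + m n] has a nonzero [coef2], and [i] and [k] are distinct. The
       other three terms are products of distinct old rows, because [idx1] is injective there and
       never hits [n + m n]. *)
    replace (b i * b k) with 0 by (unfold b, coef2; index_cases; ring).
    rewrite IHik, IHi, IHk by (unfold idx1; index_cases; lia). ring.
Qed.

Lemma square_lin (c d a b : R) :
  a * b = 0 -> (c * a + d * b) ^ 2 = c ^ 2 * a ^ 2 + d ^ 2 * b ^ 2.
Proof.
  intros H.
  transitivity (c ^ 2 * a ^ 2 + d ^ 2 * b ^ 2 + 2 * c * d * (a * b)); [ring|].
  rewrite H. ring.
Qed.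

(** * Squared rows applied to [eta] *)

Section Steps.
Context (xi eta : nat -> R) (rho : nat -> nat -> R) (m : nat -> nat) (t : nat -> R).
Context (hst : steps xi eta rho m t).

Lemma steps_m_pos (k : nat) : (1 <= m k)%nat.
Proof. apply (proj2 hst k). Qed.

Lemma steps_t_range (k : nat) : 0 < t k <= 1.
Proof. destruct (proj2 hst k) as (_ & _ & H & _). exact H. Qed.

(* The rows of index at least [n] have disjoint supports, so that squaring
   commutes with the linear combinations formed in the next step. *)
Lemma schur_square_succ (n i j : nat) :
  (n <= i)%nat ->
  Wn m t (S n) i j ^ 2 * eta j
  = coef1 n (m n) (t n) i ^ 2 * (Wn m t n (idx1 n (m n) i) j ^ 2 * eta j)
    + coef2 n (m n) (t n) i ^ 2 * (Wn m t n (n + m n)%nat j ^ 2 * eta j).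
Proof.
  intros Hi. pose proof (steps_m_pos n) as Hm.
  rewrite Wn_succ by exact Hm.
  destruct (Nat.eq_dec (idx1 n (m n) i) (n + m n)) as [E|E].
  - exfalso. revert E. unfold idx1. index_cases; lia.
  - rewrite square_lin; [ring|].
    apply Wn_tail_disjoint; [apply steps_m_pos| |lia|exact E].
    unfold idx1. index_cases; lia.
Qed.

(** Here [f] is indexed by absolute row number. Only rows from [n] on are consulted, since [idx1]
    maps that range into itself. *)
Lemma schur_square_step (n i : nat) (f : nat -> R) :
  (forall k, is_series (fun j => Wn m t n (n + k)%nat j ^ 2 * eta j) (f (n + k)%nat)) ->
  (n <= i)%nat ->
  is_series (fun j => Wn m t (S n) i j ^ 2 * eta j)
    (coef1 n (m n) (t n) i ^ 2 * f (idx1 n (m n) i)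
     + coef2 n (m n) (t n) i ^ 2 * f (n + m n)%nat).
Proof.
  intros Hf Hi.
  assert (Hf' : forall k, (n <= k)%nat ->
    is_series (fun j => Wn m t n k j ^ 2 * eta j) (f k)).
  { intros k Hk. replace k with (n + (k - n))%nat by lia. apply Hf. }
  pose proof (steps_m_pos n) as Hm.
  eapply is_series_eq;
    [apply is_series_lin; apply Hf' | intros j; symmetry; apply schur_square_succ, Hi
    | reflexivity]; [unfold idx1; index_cases; lia | lia].
Qed.

Lemma schur_square_tail (n k : nat) :
  is_series (fun j => Wn m t n (n + k)%nat j ^ 2 * eta j) (rho n k).
Proof.
  revert k. induction n as [|n IH]; intros k.
  - simpl. rewrite (proj1 hst).
    eapply is_series_eq; [apply (is_series_iid k (fun j => iid k j * eta j)) | | ].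
    + intros j. cbv beta. ring.
    + unfold iid. rewrite Nat.eqb_refl. ring.
  - eapply is_series_eq;
      [apply (schur_square_step n (S n + k) (fun i => rho n (i - n)%nat)); [|lia] | reflexivity | ].
    + intros k'. replace (n + k' - n)%nat with k' by lia. apply IH.
    + destruct (proj2 hst n) as (Hm & _ & Ht & _ & H1 & H2 & H3).
      (* The three cases [k < m n - 1], [k = m n - 1] and [k > m n - 1] match the three clauses that
         define the next sequence in [step]. *)
      unfold coef1, coef2, idx1; index_cases.
      * rewrite H1 by lia. replace (S n + k - 1 - n)%nat with k by lia. ring.
      * replace (n + m n - 1 - n)%nat with (m n - 1)%nat by lia.
        replace (n + m n - n)%nat with (m n) by lia.
        replace k with (m n - 1)%nat by lia.
        rewrite H2, !pow2_sqrt by lra. ring.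
      * rewrite H3 by lia. replace (S n + k - n)%nat with (S k) by lia. ring.
Qed.

Lemma schur_square_emitted (n : nat) :
  is_series (fun j => Wn m t (S n) n j ^ 2 * eta j) (xi n).
Proof.
  eapply is_series_eq;
    [apply (schur_square_step n n (fun i => rho n (i - n)%nat)); [|lia] | reflexivity | ].
  - intros k'. replace (n + k' - n)%nat with k' by lia. apply schur_square_tail.
  - destruct (proj2 hst n) as (Hm & _ & Ht & E & _).
    unfold coef1, coef2, idx1; index_cases.
    replace (n + m n - 1 - n)%nat with (m n - 1)%nat by lia.
    replace (n + m n - n)%nat with (m n) by lia.
    rewrite E.
    (* Squaring removes the sign, leaving the weights [t n] and [1 - t n] of the convex combination
       that equals [xi n]. *)
    replace ((- sqrt (1 - t n)) ^ 2) with (sqrt (1 - t n) ^ 2) by ring.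
    rewrite !pow2_sqrt by lra. ring.
Qed.
End Steps.

(** * Existence and uniqueness of the construction *)

Lemma nonincreasing_le (r : nat -> R) (i j : nat) :
  (forall n, r (S n) <= r n) -> (i <= j)%nat -> r j <= r i.
Proof.
  intros H Hij. induction Hij as [|j Hij IH]; [lra|]. specialize (H j). lra.
Qed.

(** The new entry is a convex combination of the two it replaces, so it still fits between their
    outer neighbours. *)
Lemma step_nonincreasing (x : R) (r : nat -> R) (m : nat) (t : R) (r' : nat -> R) :
  step x r m t r' -> (forall n, r (S n) <= r n) -> forall n, r' (S n) <= r' n.
Proof.
  intros (Hm & Hx & Ht & E & H1 & H2 & H3) Hr n.
  assert (r m <= r (m - 1)%nat) by (apply nonincreasing_le; [exact Hr|lia]).
  destruct (lt_eq_lt_dec n (m - 1)) as [[L|L]|L].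
  - rewrite (H1 n L). destruct (Nat.eq_dec (S n) (m - 1)) as [L'|L'].
    + rewrite L', H2.
      assert (r (m - 1)%nat <= r n) by (apply nonincreasing_le; [exact Hr|lia]). nra.
    + rewrite H1 by lia. apply Hr.
  - rewrite L, H2, H3 by lia.
    assert (r (S (S (m - 1))) <= r m) by (apply nonincreasing_le; [exact Hr|lia]). nra.
  - rewrite !H3 by lia. apply Hr.
Qed.

(** The target and the new entry have the same sum as the two pivots. Past the pivot, a partial sum
    therefore uses one more old term and loses exactly [x]. *)
Lemma step_sum (x : R) (r : nat -> R) (m : nat) (t : R) (r' : nat -> R) (n : nat) :
  step x r m t r' ->
  ((n < m - 1)%nat -> sum_n r' n = sum_n r n :> R) /\
  ((m - 1 <= n)%nat -> sum_n r' n = sum_n r (S n) - x :> R).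
Proof.
  intros (Hm & Hx & Ht & E & H1 & H2 & H3).
  induction n as [|n [IH1 IH2]]; (split; intros Hn).
  - rewrite !sum_O. apply H1, Hn.
  - rewrite sum_n_succ, !sum_O.
    (* Index 0 is already past the pivot only when [m] is 1. *)
    assert (E1 : m = 1%nat) by lia. subst m. change (1 - 1)%nat with 0%nat in *.
    rewrite H2, E. ring.
  - rewrite !sum_n_succ, IH1, H1 by lia. reflexivity.
  - rewrite (sum_n_succ r'), (sum_n_succ r (S n)).
    destruct (Nat.eq_dec (S n) (m - 1)) as [L|L].
    + rewrite IH1, sum_n_succ by lia.
      rewrite L, H2. replace (S (m - 1)) with m by lia. rewrite E. ring.
    + rewrite IH2, H3 by lia. ring.
Qed.

Lemma sum_n_shift (a : nat -> R) (k n : nat) :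
  sum_n (fun j => a (S k + j)%nat) n = sum_n (fun j => a (k + j)%nat) (S n) - a k :> R.
Proof.
  induction n as [|n IH].
  - rewrite sum_n_succ, !sum_O.
    replace (S k + 0)%nat with (k + 1)%nat by lia.
    replace (k + 0)%nat with k by lia. ring.
  - rewrite (sum_n_succ _ n), IH, (sum_n_succ _ (S n)).
    replace (k + S (S n))%nat with (S k + S n)%nat by lia. ring.
Qed.

Lemma sum_n_le (a b : nat -> R) (n : nat) :
  (forall j, (j <= n)%nat -> a j <= b j) -> sum_n a n <= sum_n b n.
Proof.
  induction n as [|n IH]; intros H.
  - rewrite !sum_O. apply H. lia.
  - rewrite !sum_n_succ. apply Rplus_le_compat; [apply IH; intros j Hj|]; apply H; lia.
Qed.

(** Before the pivot the comparison is termwise, as every [r j] is at least [r (m - 1)], hence at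
    least [xi k]. From the pivot on, both sums lose [xi k], and the old majorization one index later
    applies. *)
Lemma step_majorized (xi : nat -> R) (r : nat -> R) (k m : nat) (t : R) (r' : nat -> R) :
  step (xi k) r m t r' -> (forall n, xi (S n) <= xi n) -> (forall n, r (S n) <= r n) ->
  majorized (fun j => xi (k + j)%nat) r -> majorized (fun j => xi (S k + j)%nat) r'.
Proof.
  intros Hs Hxi Hr Hmaj n.
  destruct (step_sum _ _ _ _ _ n Hs) as [H1 H2].
  destruct (Nat.lt_ge_cases n (m - 1)) as [L|L].
  - rewrite H1 by exact L. apply sum_n_le. intros j Hj.
    destruct Hs as (_ & Hx & _).
    assert (r (m - 1)%nat <= r j) by (apply nonincreasing_le; [exact Hr|lia]).
    assert (xi (S k + j)%nat <= xi k) by (apply nonincreasing_le; [exact Hxi|lia]). lra.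
  - rewrite H2, sum_n_shift by exact L. specialize (Hmaj (S n)). lra.
Qed.

Lemma step_lim (x : R) (r : nat -> R) (m : nat) (t : R) (r' : nat -> R) (l : Rbar) :
  step x r m t r' -> is_lim_seq r l -> is_lim_seq r' l.
Proof.
  intros (_ & _ & _ & _ & _ & _ & H3) H.
  apply (is_lim_seq_ext_loc (fun n => r (S n))).
  - exists (S m). intros n Hn. symmetry. apply H3. lia.
  - apply -> is_lim_seq_incr_1. exact H.
Qed.

Lemma crossing (r : nat -> R) (x : R) (M : nat) :
  x <= r 0%nat -> r M < x -> exists m, (1 <= m)%nat /\ r m < x <= r (m - 1)%nat.
Proof.
  intros H0. induction M as [|M IH]; intros HM; [lra|].
  destruct (Rlt_le_dec (r M) x) as [L|L]; [exact (IH L)|].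
  exists (S M). simpl. rewrite Nat.sub_0_r. split; [lia|lra].
Qed.

Lemma step_exists (x : R) (r : nat -> R) :
  0 < x -> x <= r 0%nat -> is_lim_seq r 0 -> exists m t r', step x r m t r'.
Proof.
  intros Hx H0 Hlim.
  (* Taking [x] itself as the tolerance yields an index [M] with [r M < x]. *)
  apply is_lim_seq_spec in Hlim. destruct (Hlim (mkposreal x Hx)) as [M HM].
  simpl in HM. specialize (HM M (Nat.le_refl M)). apply Rabs_def2 in HM as [HM _].
  destruct (crossing r x M H0 ltac:(lra)) as (m & Hm & Hr).
  (* This solves the affine equation for [t]; [r m < x <= r (m - 1)] makes the denominator positive
     and puts [t] in the half-open interval from 0 to 1. *)
  set (t := (x - r m) / (r (m - 1)%nat - r m)).
  assert (Et : t * (r (m - 1)%nat - r m) = x - r m) by (unfold t; field; lra).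
  exists m, t, (fun j => if j <? m - 1 then r j else
    if j =? m - 1 then (1 - t) * r (m - 1)%nat + t * r m else r (S j)).
  split; [exact Hm|]. split; [exact Hr|]. split; [split; nra|]. split; [lra|].
  split; [|split].
  - intros j Hj. index_cases. reflexivity.
  - index_cases. reflexivity.
  - intros j Hj. index_cases. reflexivity.
Qed.

Lemma steps_exist (xi eta : nat -> R) :
  c0star xi -> c0star eta -> (forall n, 0 < xi n) -> majorized xi eta ->
  exists rho m t, steps xi eta rho m t.
Proof.
  intros (_ & Hxi & _) (_ & Heta & Hlim) Hpos Hmaj.
  (* The invariant of the recursion: [r] is nonincreasing, tends to 0 and majorizes what is left of
     [xi]. *)
  set (good := fun k r => (forall n, r (S n) <= r n) /\ is_lim_seq r 0 /\
    majorized (fun j => xi (k + j)%nat) r).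
  (* Choice requires a successor for every state, so the step is demanded only of good states and
     the others receive a dummy value. *)
  destruct (functional_choice
    (fun (s : nat * (nat -> R)) (y : nat * R * (nat -> R)) =>
       good (fst s) (snd s) -> step (xi (fst s)) (snd s) (fst (fst y)) (snd (fst y)) (snd y)))
    as [f Hf].
  { intros [k r]. simpl.
    destruct (Rlt_le_dec (r 0%nat) (xi k)) as [L|L].
    (* This state is not good: majorization at index 0 would give [xi k <= r 0]. *)
    - exists (0%nat, 0, r). intros (_ & _ & H). specialize (H 0%nat).
      rewrite !sum_O, Nat.add_0_r in H. lra.
    - destruct (classic (is_lim_seq r 0)) as [H|H].
      + destruct (step_exists (xi k) r (Hpos k) L H) as (m & t & r' & Hs).
        exists (m, t, r'). intros _. exact Hs.
      + exists (0%nat, 0, r). intros (_ & H' & _). contradiction. }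
  set (rho := fix rho k := match k with O => eta | S p => snd (f (p, rho p)) end).
  assert (Hgood : forall k, good k (rho k)).
  { induction k as [|k IH].
    - split; [exact Heta|]. split; [exact Hlim|exact Hmaj].
    - pose proof (Hf (k, rho k) IH) as Hs. simpl in Hs. destruct IH as (I1 & I2 & I3).
      split; [|split]; simpl.
      + exact (step_nonincreasing _ _ _ _ _ Hs I1).
      + exact (step_lim _ _ _ _ _ _ Hs I2).
      + exact (step_majorized _ _ _ _ _ _ Hs Hxi I1 I3). }
  exists rho, (fun k => fst (fst (f (k, rho k)))), (fun k => snd (fst (f (k, rho k)))).
  split; [reflexivity|]. intros k. exact (Hf (k, rho k) (Hgood k)).
Qed.

Lemma steps_nonincreasing (xi eta : nat -> R) rho m t (k : nat) :
  steps xi eta rho m t -> (forall n, eta (S n) <= eta n) ->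
  forall n, rho k (S n) <= rho k n.
Proof.
  intros [H0 Hs] Heta. induction k as [|k IH].
  - intros n. rewrite !H0. apply Heta.
  - exact (step_nonincreasing _ _ _ _ _ (Hs k) IH).
Qed.

(** If [m1 < m2], monotonicity gives [r1 (m2 - 1) <= r1 m1 < x], against [x <= r1 (m2 - 1)]; the
    other order is symmetric. Then [t] is determined because the gap between the pivots is
    positive. *)
Lemma step_unique (x : R) (r1 r2 : nat -> R) (m1 m2 : nat) (t1 t2 : R) (r1' r2' : nat -> R) :
  (forall n, r1 (S n) <= r1 n) -> (forall n, r1 n = r2 n) ->
  step x r1 m1 t1 r1' -> step x r2 m2 t2 r2' ->
  m1 = m2 /\ t1 = t2 /\ forall n, r1' n = r2' n.
Proof.
  intros Hr Heq (Hm1 & Hx1 & Ht1 & E1 & A1 & B1 & C1) (Hm2 & Hx2 & Ht2 & E2 & A2 & B2 & C2).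
  rewrite <- !Heq in *.
  assert (Em : m1 = m2).
  { destruct (lt_eq_lt_dec m1 m2) as [[L|L]|L]; [exfalso|exact L|exfalso].
    - assert (r1 (m2 - 1)%nat <= r1 m1) by (apply nonincreasing_le; [exact Hr|lia]). lra.
    - assert (r1 (m1 - 1)%nat <= r1 m2) by (apply nonincreasing_le; [exact Hr|lia]). lra. }
  subst m2.
  assert (Et : t1 = t2).
  { apply (Rmult_eq_reg_r (r1 (m1 - 1)%nat - r1 m1)); lra. }
  subst t2. split; [reflexivity|]. split; [reflexivity|].
  intros n. destruct (lt_eq_lt_dec n (m1 - 1)) as [[L|L]|L].
  - rewrite A1, A2 by exact L. apply Heq.
  - subst n. rewrite B1, B2. reflexivity.
  - rewrite C1, C2 by exact L. apply Heq.
Qed.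

Lemma steps_unique (xi eta : nat -> R) rho1 rho2 m1 m2 t1 t2 :
  (forall n, eta (S n) <= eta n) ->
  steps xi eta rho1 m1 t1 -> steps xi eta rho2 m2 t2 -> m1 = m2 /\ t1 = t2.
Proof.
  intros Heta H1 H2.
  assert (Hrho : forall k n, rho1 k n = rho2 k n).
  { induction k as [|k IH].
    - intros n. rewrite (proj1 H1), (proj1 H2). reflexivity.
    - exact (proj2 (proj2 (step_unique _ _ _ _ _ _ _ _ _
        (steps_nonincreasing _ _ _ _ _ k H1 Heta) IH (proj2 H1 k) (proj2 H2 k)))). }
  pose proof (fun k => step_unique _ _ _ _ _ _ _ _ _
    (steps_nonincreasing _ _ _ _ _ k H1 Heta) (Hrho k) (proj2 H1 k) (proj2 H2 k)) as H.
  split; apply functional_extensionality; intros k; apply H.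
Qed.

Lemma sum_n_eq (a b : nat -> R) (n : nat) :
  (forall j, a j = b j) -> sum_n a n = sum_n b n :> R.
Proof. intros H. exact (sum_n_ext a b n H). Qed.

(** * Matrices with orthonormal rows on real square-summable sequences *)

Definition l2 (a : nat -> R) : Prop := ex_series (fun n => a n ^ 2).

Definition dot (a b : nat -> R) : R := Series (fun n => a n * b n).

Definition sqnorm (a : nat -> R) : R := Series (fun n => a n ^ 2).

Lemma l2_dot (a b : nat -> R) : l2 a -> l2 b -> is_series (fun n => a n * b n) (dot a b).
Proof.
  intros Ha Hb. apply Series_correct.
  apply (ex_series_le (V := R_CompleteNormedModule) _ (fun n => 1 * a n ^ 2 + 1 * b n ^ 2)).
  - intros n. change (Rabs (a n * b n) <= 1 * a n ^ 2 + 1 * b n ^ 2).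
    apply Rabs_le. nra.
  - eexists. apply is_series_lin; apply Series_correct; [exact Ha|exact Hb].
Qed.

Lemma l2_lin (c d : R) (a b : nat -> R) :
  l2 a -> l2 b -> l2 (fun n => c * a n + d * b n).
Proof.
  intros Ha Hb.
  eexists. eapply is_series_eq; [| |reflexivity].
  - exact (is_series_lin 1 (2 * c * d) _ _ _ _
      (is_series_lin (c ^ 2) (d ^ 2) _ _ _ _ (Series_correct _ Ha) (Series_correct _ Hb))
      (l2_dot a b Ha Hb)).
  - intros n. cbv beta. ring.
Qed.

Lemma is_series_le (f g : nat -> R) (a b : R) :
  is_series f a -> is_series g b -> (forall n, f n <= g n) -> a <= b.
Proof.
  intros Hf Hg H.
  apply (is_lim_seq_le (sum_n f) (sum_n g) a b); [|exact Hf|exact Hg].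
  intros n. apply sum_n_le. intros j _. apply H.
Qed.

Lemma is_series_pos (f : nat -> R) (a : R) : is_series f a -> (forall n, 0 <= f n) -> 0 <= a.
Proof.
  intros Hf H. apply (is_series_le (fun n => 0 * f n + 0 * f n) f _ _
    (is_series_eq _ _ _ 0 (is_series_lin 0 0 _ _ _ _ Hf Hf) (fun n => eq_refl) ltac:(ring)) Hf).
  intros n. specialize (H n). lra.
Qed.

Lemma sqnorm_ge0 (a : nat -> R) : l2 a -> 0 <= sqnorm a.
Proof.
  intros Ha. apply (is_series_pos _ _ (Series_correct _ Ha)). intros n. apply pow2_ge_0.
Qed.

Lemma cauchy_schwarz (a b : nat -> R) : l2 a -> l2 b -> dot a b ^ 2 <= sqnorm a * sqnorm b.
Proof.
  intros Ha Hb.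
  (* The squared norm of [c a + d b] is a nonnegative quadratic form in [c] and [d]. *)
  assert (H : forall c d, 0 <= c ^ 2 * sqnorm a + d ^ 2 * sqnorm b + 2 * c * d * dot a b).
  { intros c d.
    assert (Hs : is_series (fun n => (c * a n + d * b n) ^ 2)
      (1 * (c ^ 2 * sqnorm a + d ^ 2 * sqnorm b) + 2 * c * d * dot a b)).
    { eapply is_series_eq; [| |reflexivity].
      - exact (is_series_lin 1 (2 * c * d) _ _ _ _
          (is_series_lin (c ^ 2) (d ^ 2) _ _ _ _ (Series_correct _ Ha) (Series_correct _ Hb))
          (l2_dot a b Ha Hb)).
      - intros n. cbv beta. ring. }
    apply is_series_pos in Hs; [lra|]. intros n. apply pow2_ge_0. }
  pose proof (sqnorm_ge0 a Ha). pose proof (sqnorm_ge0 b Hb).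
  destruct (Req_dec (sqnorm a) 0) as [E|E].
  - destruct (Req_dec (dot a b) 0) as [E'|E']; [rewrite E', E; lra|].
    (* With [sqnorm a] zero the form is affine in [c]; this choice gives it the value -1. *)
    specialize (H (- (sqnorm b + 1) / (2 * dot a b)) 1). rewrite E in H. exfalso.
    replace (2 * (- (sqnorm b + 1) / (2 * dot a b)) * 1 * dot a b)
      with (- (sqnorm b + 1)) in H by (field; exact E').
    lra.
  (* The form becomes [sqnorm a * (sqnorm a * sqnorm b - dot a b ^ 2)], whose first factor is
     positive. *)
  - specialize (H (- dot a b) (sqnorm a)). nra.
Qed.

Lemma sum_n_nonneg_bounded (a : nat -> R) (M : R) :
  (forall n, 0 <= a n) -> (forall n, sum_n a n <= M) -> ex_series a /\ Series a <= M.
Proof.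
  intros Ha HM.
  assert (Hex : ex_finite_lim_seq (sum_n a)).
  { apply (ex_finite_lim_seq_incr _ M); [|exact HM].
    intros n. rewrite sum_n_succ. specialize (Ha (S n)). lra. }
  destruct Hex as [l Hl]. split; [exists l; exact Hl|].
  rewrite (is_series_unique a l Hl).
  exact (is_lim_seq_le (sum_n a) (fun _ => M) l M HM Hl (is_lim_seq_const M)).
Qed.

(** * Bessel's inequality, the transpose and the adjoint relation *)

Section Orthonormal.
Context (W : imatrix).
Context (hW : forall i k, is_series (fun j => W i j * W k j) (iid i k)).

Definition mat_vec (a : nat -> R) (i : nat) : R := Series (fun j => W i j * a j).

Definition tr_vec (y : nat -> R) (j : nat) : R := Series (fun i => W i j * y i).

Lemma l2_row (i : nat) : l2 (W i).
Proof.
  eexists. eapply is_series_eq; [apply (hW i i)| |reflexivity]. intros n. cbv beta. ring.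
Qed.

Lemma mat_vec_series (a : nat -> R) (i : nat) :
  l2 a -> is_series (fun j => W i j * a j) (mat_vec a i).
Proof. apply l2_dot, l2_row. Qed.

(* [a] minus its projection onto the span of the first [n] rows. *)
Fixpoint residual (a : nat -> R) (n : nat) (j : nat) : R :=
  match n with
  | O => a j
  | S p => residual a p j - mat_vec a p * W p j
  end.

(** Only multiples of rows before [k] have been subtracted, and these are orthogonal to row [k]. *)
Lemma residual_dot (a : nat -> R) (n k : nat) :
  l2 a -> (n <= k)%nat -> is_series (fun j => W k j * residual a n j) (mat_vec a k).
Proof.
  intros Ha. revert k. induction n as [|n IH]; intros k Hk.
  - apply mat_vec_series, Ha.
  - eapply is_series_eq;
      [apply (is_series_lin 1 (- mat_vec a n) _ _ _ _ (IH k ltac:(lia)) (hW k n)) | |].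
    + intros j. cbn [residual]. ring.
    + unfold iid. index_cases. ring.
Qed.

(** Pythagoras: the residual pairs with the next unit row to the coefficient about to be removed, so
    its squared norm drops by the square of that coefficient. *)
Lemma residual_sqnorm (a : nat -> R) (n : nat) :
  l2 a ->
  is_series (fun j => residual a (S n) j ^ 2)
    (sqnorm a - sum_n (fun i => mat_vec a i ^ 2) n).
Proof.
  intros Ha.
  assert (H : forall n s, is_series (fun j => residual a n j ^ 2) s ->
    is_series (fun j => residual a (S n) j ^ 2) (s - mat_vec a n ^ 2)).
  { intros p s Hs. eapply is_series_eq;
      [apply (is_series_lin 1 1 _ _ _ _
        (is_series_lin 1 (- 2 * mat_vec a p) _ _ _ _ Hs (residual_dot a p p Ha (Nat.le_refl p)))
        (is_series_lin (mat_vec a p ^ 2) 0 _ _ _ _ (hW p p) (hW p p))) | |].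
    - intros j. cbn [residual]. ring.
    - unfold iid. rewrite Nat.eqb_refl. ring. }
  induction n as [|n IH].
  - rewrite sum_O. apply H, Series_correct, Ha.
  - rewrite sum_n_succ. eapply is_series_eq; [apply (H _ _ IH)|reflexivity|ring].
Qed.

Lemma bessel (a : nat -> R) :
  l2 a -> l2 (mat_vec a) /\ sqnorm (mat_vec a) <= sqnorm a.
Proof.
  intros Ha. apply sum_n_nonneg_bounded.
  - intros n. apply pow2_ge_0.
  - intros n.
    pose proof (is_series_pos _ _ (residual_sqnorm a n Ha) (fun j => pow2_ge_0 _)). lra.
Qed.

Lemma l2_basis (k : nat) : l2 (iid k).
Proof.
  eexists. eapply is_series_eq; [apply (is_series_iid k (iid k))| |reflexivity].
  intros n. cbv beta. ring.
Qed.

Lemma mat_vec_basis (i k : nat) : mat_vec (iid k) i = W i k.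
Proof.
  apply is_series_unique. eapply is_series_eq; [apply (is_series_iid k (W i))| |reflexivity].
  intros n. cbv beta. ring.
Qed.

(** Column [j] is the image of the [j]-th basis vector, so Bessel applies. This makes the series in
    [tr_vec] converge. *)
Lemma l2_column (j : nat) : l2 (fun i => W i j).
Proof.
  destruct (bessel (iid j) (l2_basis j)) as [H _].
  apply (ex_series_ext (fun i => mat_vec (iid j) i ^ 2)); [|exact H].
  intros i. rewrite mat_vec_basis. reflexivity.
Qed.

Lemma tr_vec_series (y : nat -> R) (j : nat) :
  l2 y -> is_series (fun i => W i j * y i) (tr_vec y j).
Proof. apply l2_dot, l2_column. Qed.

Definition trunc (n : nat) (a : nat -> R) (j : nat) : R := if j <=? n then a j else 0.

Lemma trunc_series (n : nat) (a b : nat -> R) :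
  is_series (fun j => b j * trunc n a j) (sum_n (fun j => b j * a j) n).
Proof.
  induction n as [|n IH].
  - rewrite sum_O. eapply is_series_eq;
      [apply (is_series_iid 0 (fun j => b j * a j))| |reflexivity].
    intros j. unfold trunc, iid. destruct j; simpl; ring.
  - rewrite sum_n_succ. eapply is_series_eq;
      [apply (is_series_lin 1 1 _ _ _ _ IH (is_series_iid (S n) (fun j => b j * a j)))| |ring].
    intros j. cbv beta. unfold trunc, iid. index_cases; subst; ring.
Qed.

Lemma l2_trunc (n : nat) (a : nat -> R) : l2 (trunc n a).
Proof.
  eexists. eapply is_series_eq; [apply (trunc_series n a a)| |reflexivity].
  intros j. unfold trunc. index_cases; ring.
Qed.

Lemma sqnorm_trunc (n : nat) (a : nat -> R) : sqnorm (trunc n a) = sum_n (fun j => a j ^ 2) n.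
Proof.
  apply is_series_unique. eapply is_series_eq; [apply (trunc_series n a a)| |].
  - intros j. unfold trunc. index_cases; ring.
  - apply sum_n_eq. intros j. ring.
Qed.

(** Only finitely many columns are involved, so exchanging the two sums is finite additivity of
    series. *)
Lemma trunc_adjoint (n : nat) (x y : nat -> R) :
  l2 y -> dot (mat_vec (trunc n x)) y = sum_n (fun j => tr_vec y j * x j) n.
Proof.
  intros Hy. apply is_series_unique.
  apply (is_series_ext (fun i => sum_n (fun j => W i j * x j) n * y i)).
  { intros i. f_equal. symmetry. apply is_series_unique, trunc_series. }
  induction n as [|n IH].
  - rewrite sum_O. eapply is_series_eq;
      [apply (is_series_lin (x 0%nat) 0 _ _ _ _
        (tr_vec_series y 0 Hy) (tr_vec_series y 0 Hy))| |ring].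
    intros i. rewrite sum_O. ring.
  - rewrite sum_n_succ. eapply is_series_eq;
      [apply (is_series_lin 1 (x (S n)) _ _ _ _ IH (tr_vec_series y (S n) Hy))| |ring].
    intros i. rewrite sum_n_succ. ring.
Qed.

Lemma tr_vec_bounded (y : nat -> R) :
  l2 y -> l2 (tr_vec y) /\ sqnorm (tr_vec y) <= sqnorm y.
Proof.
  intros Hy. apply sum_n_nonneg_bounded; [intros n; apply pow2_ge_0|].
  (* Test [W^T y] against its own truncation [z]: [|z|^2 = <W z, y> <= |z| |y|]. *)
  intros n. set (z := trunc n (tr_vec y)).
  assert (Hz : l2 z) by apply l2_trunc.
  destruct (bessel z Hz) as [H1 H2].
  pose proof (cauchy_schwarz _ _ H1 Hy) as H3.
  unfold z at 1 in H3. rewrite trunc_adjoint in H3 by exact Hy.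
  rewrite (sum_n_eq _ (fun j => tr_vec y j ^ 2)) in H3 by (intros j; ring).
  unfold z in H2 at 2. rewrite sqnorm_trunc in H2.
  set (s := sum_n (fun j => tr_vec y j ^ 2) n) in *.
  pose proof (sqnorm_ge0 _ Hy). pose proof (sqnorm_ge0 _ H1).
  assert (s ^ 2 <= s * sqnorm y) by nra.
  destruct (Rle_lt_dec s 0); nra.
Qed.

Lemma tail_lim (x : nat -> R) :
  l2 x -> is_lim_seq (fun n => sqnorm (fun j => x j - trunc n x j)) 0.
Proof.
  intros Hx.
  apply (is_lim_seq_ext (fun n => sqnorm x - sum_n (fun j => x j ^ 2) n)).
  - intros n. symmetry. apply is_series_unique.
    eapply is_series_eq;
      [apply (is_series_lin 1 (-1) _ _ _ _ (Series_correct _ Hx) (trunc_series n x x))| |].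
    + intros j. cbv beta. unfold trunc. index_cases; ring.
    + rewrite (sum_n_eq _ (fun j => x j ^ 2)) by (intros j; ring). unfold sqnorm. ring.
  - replace (Finite 0) with (Finite (sqnorm x - sqnorm x)) by (f_equal; ring).
    apply is_lim_seq_minus'; [apply is_lim_seq_const|exact (Series_correct _ Hx)].
Qed.

(* Exact for truncations of [x]; the error tends to 0 by Bessel and Cauchy-Schwarz. *)
Lemma real_adjoint (x y : nat -> R) :
  l2 x -> l2 y -> dot (mat_vec x) y = dot x (tr_vec y).
Proof.
  intros Hx Hy.
  destruct (bessel x Hx) as [HTx _]. destruct (tr_vec_bounded y Hy) as [HTy _].
  set (e := fun n j => x j - trunc n x j).
  assert (He : forall n, l2 (e n)).
  { intros n. apply (ex_series_ext (fun j => (1 * x j + (-1) * trunc n x j) ^ 2)).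
    - intros j. unfold e. f_equal. ring.
    - apply l2_lin; [exact Hx|apply l2_trunc]. }
  assert (Hd : forall n, dot (mat_vec (e n)) y
    = dot (mat_vec x) y - sum_n (fun j => x j * tr_vec y j) n).
  { intros n. rewrite (sum_n_eq _ (fun j => tr_vec y j * x j)) by (intros j; ring).
    rewrite <- (trunc_adjoint n x y Hy).
    apply is_series_unique.
    eapply is_series_eq;
      [apply (is_series_lin 1 (-1) _ _ _ _ (l2_dot _ _ HTx Hy)
        (l2_dot _ _ (proj1 (bessel _ (l2_trunc n x))) Hy))| |ring].
    intros i. cbv beta.
    replace (mat_vec (e n) i) with (1 * mat_vec x i + (-1) * mat_vec (trunc n x) i); [ring|].
    symmetry. apply is_series_unique.
    eapply is_series_eq;
      [apply (is_series_lin 1 (-1) _ _ _ _ (mat_vec_series x i Hx)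
        (mat_vec_series _ i (l2_trunc n x)))| |reflexivity].
    intros j. unfold e. ring. }
  (* Squares are used because Cauchy-Schwarz is stated for the square of [dot]. *)
  assert (Hlim : is_lim_seq (fun n => dot (mat_vec (e n)) y ^ 2) 0).
  { apply (is_lim_seq_le_le (fun _ => 0) _ (fun n => sqnorm (e n) * sqnorm y)).
    - intros n. split; [apply pow2_ge_0|].
      destruct (bessel (e n) (He n)) as [H1 H2].
      pose proof (cauchy_schwarz _ _ H1 Hy). pose proof (sqnorm_ge0 _ Hy). nra.
    - apply is_lim_seq_const.
    - replace (Finite 0) with (Rbar_mult 0 (sqnorm y)) by (simpl; f_equal; ring).
      apply is_lim_seq_scal_r, tail_lim, Hx. }
  (* The same sequence tends to the squared defect of the adjoint relation, which is therefore 0. *)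
  assert (Hlim' : is_lim_seq (fun n => dot (mat_vec (e n)) y ^ 2)
    ((dot (mat_vec x) y - dot x (tr_vec y)) ^ 2)).
  { assert (H : is_lim_seq (fun n => dot (mat_vec (e n)) y)
      (dot (mat_vec x) y - dot x (tr_vec y))).
    { apply (is_lim_seq_ext (fun n => dot (mat_vec x) y - sum_n (fun j => x j * tr_vec y j) n)).
      - intros n. symmetry. apply Hd.
      - apply is_lim_seq_minus'; [apply is_lim_seq_const|exact (l2_dot _ _ Hx HTy)]. }
    apply (is_lim_seq_ext (fun n => dot (mat_vec (e n)) y * dot (mat_vec (e n)) y)).
    - intros n. ring.
    - replace ((dot (mat_vec x) y - dot x (tr_vec y)) ^ 2)
        with ((dot (mat_vec x) y - dot x (tr_vec y)) * (dot (mat_vec x) y - dot x (tr_vec y)))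
        by ring.
      apply is_lim_seq_mult'; exact H. }
  pose proof (is_lim_seq_unique _ _ Hlim) as E1.
  rewrite (is_lim_seq_unique _ _ Hlim') in E1. injection E1 as E1.
  nra.
Qed.

Lemma mat_vec_tr_vec (y : nat -> R) (i : nat) : l2 y -> mat_vec (tr_vec y) i = y i.
Proof.
  intros Hy. transitivity (dot (W i) (tr_vec y)); [reflexivity|].
  (* [<W_i, W^T y> = <W W_i, y>], and [W W_i] is the [i]-th basis vector. *)
  rewrite <- real_adjoint by (apply l2_row || exact Hy).
  apply is_series_unique.
  eapply is_series_eq; [apply (is_series_iid i y)| |reflexivity].
  intros k. cbv beta. f_equal. rewrite iid_sym. symmetry. apply is_series_unique, hW.
Qed.

End Orthonormal.

(** * Passage to complex sequences *)

(** Two-term linearity serves twice: coefficients 1 and 1 give additivity, and the parts of a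
    complex scalar give complex homogeneity of [complexify L]. *)
Definition real_contraction (L : (nat -> R) -> nat -> R) : Prop :=
  (forall a, l2 a -> l2 (L a) /\ sqnorm (L a) <= sqnorm a) /\
  (forall c d a b, l2 a -> l2 b ->
     forall n, L (fun k => c * a k + d * b k) n = c * L a n + d * L b n).

Definition complexify (L : (nat -> R) -> nat -> R) (x : nat -> C) : nat -> C :=
  fun n => (L (fun k => Re (x k)) n, L (fun k => Im (x k)) n).

Lemma Cmod_sq (z : C) : Cmod z ^ 2 = Re z ^ 2 + Im z ^ 2.
Proof. unfold Cmod, Re, Im. rewrite pow2_sqrt by nra. reflexivity. Qed.

Lemma ell2_parts (x : nat -> C) :
  ell2 x <-> l2 (fun n => Re (x n)) /\ l2 (fun n => Im (x n)).
Proof.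
  split.
  - intros H. split; (apply (ex_series_le (V := R_CompleteNormedModule) _ _)
      with (2 := H)); intros n; cbv beta; rewrite Cmod_sq.
    + change (Rabs (Re (x n) ^ 2) <= Re (x n) ^ 2 + Im (x n) ^ 2).
      rewrite Rabs_pos_eq by apply pow2_ge_0. pose proof (pow2_ge_0 (Im (x n))). lra.
    + change (Rabs (Im (x n) ^ 2) <= Re (x n) ^ 2 + Im (x n) ^ 2).
      rewrite Rabs_pos_eq by apply pow2_ge_0. pose proof (pow2_ge_0 (Re (x n))). lra.
  - intros [H1 H2]. apply (ex_series_ext (fun n => Re (x n) ^ 2 + Im (x n) ^ 2)).
    + intros n. symmetry. apply Cmod_sq.
    + exact (ex_series_plus _ _ H1 H2).
Qed.

Lemma norm2_parts (x : nat -> C) :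
  ell2 x -> norm2 x = sqrt (sqnorm (fun n => Re (x n)) + sqnorm (fun n => Im (x n))).
Proof.
  intros H. apply ell2_parts in H as [H1 H2]. unfold norm2, sqnorm.
  rewrite <- Series_plus by assumption.
  f_equal. apply Series_ext. intros n. apply Cmod_sq.
Qed.

Lemma inner_parts (x y : nat -> C) :
  ell2 x -> ell2 y ->
  inner x y =
    (dot (fun n => Re (x n)) (fun n => Re (y n)) + dot (fun n => Im (x n)) (fun n => Im (y n)),
     dot (fun n => Im (x n)) (fun n => Re (y n)) - dot (fun n => Re (x n)) (fun n => Im (y n))).
Proof.
  intros Hx Hy. apply ell2_parts in Hx as [X1 X2]. apply ell2_parts in Hy as [Y1 Y2].
  unfold inner. f_equal; apply is_series_unique.
  - eapply is_series_eq;
      [apply (is_series_lin 1 1 _ _ _ _ (l2_dot _ _ X1 Y1) (l2_dot _ _ X2 Y2))| |ring].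
    intros n. unfold Cconj, Cmult, Re, Im. simpl. ring.
  - eapply is_series_eq;
      [apply (is_series_lin 1 (-1) _ _ _ _ (l2_dot _ _ X2 Y1) (l2_dot _ _ X1 Y2))| |ring].
    intros n. unfold Cconj, Cmult, Re, Im. simpl. ring.
Qed.

Lemma complexify_bounded (L : (nat -> R) -> nat -> R) :
  real_contraction L -> bounded_op (complexify L).
Proof.
  intros [HL Hlin].
  assert (Hell : forall x, ell2 x -> ell2 (complexify L x)).
  { intros x Hx. apply ell2_parts in Hx as [H1 H2]. apply ell2_parts.
    split; apply HL; assumption. }
  split; [exact Hell|]. split; [|split].
  - intros x y Hx Hy n. apply ell2_parts in Hx as [X1 X2]. apply ell2_parts in Hy as [Y1 Y2].
    pose proof (Hlin 1 1 _ _ X1 Y1 n) as E1. pose proof (Hlin 1 1 _ _ X2 Y2 n) as E2.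
    unfold complexify, Cplus. simpl. f_equal.
    + etransitivity; [|etransitivity; [exact E1|ring]]. f_equal.
      apply functional_extensionality. intros k. unfold Re. simpl. ring.
    + etransitivity; [|etransitivity; [exact E2|ring]]. f_equal.
      apply functional_extensionality. intros k. unfold Im. simpl. ring.
  - intros a x Hx n. apply ell2_parts in Hx as [X1 X2].
    pose proof (Hlin (fst a) (- snd a) _ _ X1 X2 n) as E1.
    pose proof (Hlin (fst a) (snd a) _ _ X2 X1 n) as E2.
    unfold complexify, Cmult. simpl. f_equal.
    + etransitivity; [|etransitivity; [exact E1|ring]]. f_equal.
      apply functional_extensionality. intros k. unfold Re, Im. simpl. ring.
    + exact E2.
  - exists 1. intros x Hx. rewrite Rmult_1_l, !norm2_parts by auto.
    apply ell2_parts in Hx as [X1 X2].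
    apply sqrt_le_1_alt, Rplus_le_compat; apply HL; assumption.
Qed.

Lemma complexify_adjoint (L Lt : (nat -> R) -> nat -> R) :
  (forall a, l2 a -> l2 (L a)) -> (forall a, l2 a -> l2 (Lt a)) ->
  (forall a b, l2 a -> l2 b -> dot (L a) b = dot a (Lt b)) ->
  adjoint (complexify L) (complexify Lt).
Proof.
  intros HL HLt Hadj x y Hx Hy.
  assert (Hx' := Hx). assert (Hy' := Hy).
  apply ell2_parts in Hx' as [X1 X2]. apply ell2_parts in Hy' as [Y1 Y2].
  rewrite !inner_parts; try assumption;
    try (apply ell2_parts; split; (apply HL || apply HLt); assumption).
  unfold complexify. simpl Re. simpl Im.
  f_equal; f_equal; apply Hadj; assumption.
Qed.

Lemma ell2_basis (k : nat) : ell2 (basis k).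
Proof.
  apply ell2_parts. split.
  - exact (ex_series_ext _ _ (fun n => f_equal (fun r => r ^ 2) (iid_sym k n)) (l2_basis k)).
  - apply (ex_series_ext (fun n => 0 * iid k n ^ 2)).
    + intros n. unfold basis. simpl. ring.
    + exact (ex_series_scal 0 _ (l2_basis k)).
Qed.

Lemma inner_basis (x : nat -> C) (i : nat) : ell2 x -> inner x (basis i) = x i.
Proof.
  intros Hx. unfold inner. rewrite (surjective_pairing (x i)). f_equal; apply is_series_unique.
  - eapply is_series_eq; [apply (is_series_iid i (fun n => Re (x n)))| |reflexivity].
    intros n. unfold basis, Cconj, Cmult, Re, Im. simpl. rewrite (iid_sym n i). ring.
  - eapply is_series_eq; [apply (is_series_iid i (fun n => Im (x n)))| |reflexivity].
    intros n. unfold basis, Cconj, Cmult, Re, Im. simpl. rewrite (iid_sym n i). ring.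
Qed.

Lemma orthonormal_coisometry (W : imatrix) :
  (forall i k, is_series (fun j => W i j * W k j) (iid i k)) -> coisometry W.
Proof.
  intros hW.
  assert (HT : real_contraction (mat_vec W)).
  { split; [exact (bessel W hW)|]. intros c d a b Ha Hb n. apply is_series_unique.
    eapply is_series_eq;
      [apply (is_series_lin c d _ _ _ _ (mat_vec_series W hW a n Ha) (mat_vec_series W hW b n Hb))
      | |reflexivity].
    intros j. cbv beta. ring. }
  assert (HTt : real_contraction (tr_vec W)).
  { split; [exact (tr_vec_bounded W hW)|]. intros c d a b Ha Hb n. apply is_series_unique.
    eapply is_series_eq;
      [apply (is_series_lin c d _ _ _ _ (tr_vec_series W hW a n Ha) (tr_vec_series W hW b n Hb))
      | |reflexivity].
    intros j. cbv beta. ring. }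
  pose proof (complexify_bounded _ HT) as BT.
  exists (complexify (mat_vec W)). split; [exact BT|]. split.
  - intros i j. rewrite inner_basis by apply (proj1 BT), ell2_basis.
    unfold complexify, RtoC. f_equal.
    + rewrite <- mat_vec_basis. f_equal. apply functional_extensionality. intros k. apply iid_sym.
    (* Basis vectors have zero imaginary part; the zero series is obtained from a convergent one
       with coefficients 0. *)
    + apply is_series_unique. eapply is_series_eq;
        [apply (is_series_lin 0 0 _ _ _ _ (hW i i) (hW i i))| |ring].
      intros k. unfold basis. simpl. ring.
  - exists (complexify (tr_vec W)). split; [exact (complexify_bounded _ HTt)|]. split.
    + apply complexify_adjoint; [apply HT|apply HTt|exact (real_adjoint W hW)].
    + intros x Hx n. apply ell2_parts in Hx as [X1 X2].
      rewrite (surjective_pairing (x n)). unfold complexify. simpl Re. simpl Im.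
      f_equal; apply (mat_vec_tr_vec W hW); assumption.
Qed.

Theorem theorem3p7 (xi eta : nat -> R)
  (hxi : c0star xi) (heta : c0star eta) (hpos : forall n, 0 < xi n)
  (hmaj : majorized xi eta) :
  (exists! W : imatrix, is_W xi eta W) /\
  (forall W : imatrix, is_W xi eta W ->
     coisometry W /\ is_apply (schur_square W) eta xi).
Proof.
  split.
  - destruct (steps_exist xi eta hxi heta hpos hmaj) as (rho & m & t & Hst).
    (* Row [i] is taken from the first approximant in which it is final. *)
    exists (fun i => Wn m t (S i) i). split.
    + exists rho, m, t. split; [exact Hst|]. intros n i j Hi. symmetry.
      exact (Wn_stable m t (steps_m_pos _ _ _ _ _ Hst) n i j Hi).
    + intros W' (rho' & m' & t' & Hst' & HW').
      destruct (steps_unique _ _ _ _ _ _ _ _ (proj1 (proj2 heta)) Hst Hst') as [<- <-].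
      apply functional_extensionality. intros i.
      apply functional_extensionality. intros j. symmetry. apply HW'. lia.
  - intros W (rho & m & t & Hst & HW). split.
    + apply orthonormal_coisometry. intros i k.
      (* At stage [S (max i k)] both rows are already final. *)
      eapply is_series_eq;
        [apply (Wn_orthonormal m t (steps_m_pos _ _ _ _ _ Hst) (steps_t_range _ _ _ _ _ Hst)
                  (S (max i k)) i k) | | reflexivity].
      intros j. cbv beta. rewrite !(HW (S (max i k))) by lia. reflexivity.
    + intros i. eapply is_series_eq;
        [apply (schur_square_emitted _ _ _ _ _ Hst i) | | reflexivity].
      intros j. unfold schur_square. cbv beta. rewrite (HW (S i) i j) by lia. reflexivity.
Qed.
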